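(* Let $M_1\times_f M_2$ be a warped product manifold and let $\zeta\in\mathfrak{X}(M_1\times_f M_2)$ be a nontrivial $2$-Killing vector field on $M_1\times_f M_2$. If $D_\zeta\zeta$ is parallel along a curve $\gamma$, then $$K(\zeta,\dot\gamma)\ge 0.$$
   Context: Let $(M_1,g_1)$ and $(M_2,g_2)$ be smooth Riemannian manifolds and $f:M_1\to(0,\infty)$ a smooth function. The warped product $M_1\times_f M_2$ is the product manifold $M_1\times M_2$ with the metric $g=\pi_1^*(g_1)\oplus(f\circ\pi_1)^2\pi_2^*(g_2)$, where $\pi_i:M_1\times M_2\to M_i$ are the natural projections. $\mathfrak{X}(M)$ denotes the smooth vector fields on $M$, and $D$ is the Levi-Civita connection of $g$. A vector field $\zeta$ is $2$-Killing if $\mathcal{L}_\zeta\mathcal{L}_\zeta g=0$, where $\mathcal{L}_\zeta$ is the Lie derivative; nontrivial means not identically zero. $D_\zeta\zeta$ is parallel along $\gamma$ if $D_{\dot\gamma}(D_\zeta\zeta)=0$ along $\gamma$. $K(\zeta,\dot\gamma)$ is the sectional curvature of $g$ on the plane spanned by $\zeta$ and $\dot\gamma$ at points of $\gamma$ (where these vectors are linearly independent). *)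

(* Defs.v *)
From mathcomp Require Import all_boot all_order all_algebra.
From mathcomp Require Import all_classical all_reals all_analysis.
From mathcomp Require Import ring.

Set Implicit Arguments.
Unset Strict Implicit.
Unset Printing Implicit Defensive.

Import Order.TTheory GRing.Theory Num.Theory.
Import numFieldNormedType.Exports.

Local Open Scope classical_set_scope.
Local Open Scope ring_scope.

Section Smooth.
Context {R : realType} {V W : normedModType R}.

(* Used with V finite-dimensional and U open, where it is the usual C^k:
   all directional derivatives of order <= k exist and are continuous on U. *)
Fixpoint Ck_on (k : nat) (U : set V) (f : V -> W) : Prop :=
  (forall x, U x -> {for x, continuous f}) /\
  (if k is k'.+1 then
     (forall v x, U x -> derivable f x v) /\ (forall v, Ck_on k' U ('D_v f))
   else True).

Definition smooth_on (U : set V) (f : V -> W) : Prop :=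
  forall k, Ck_on k U f.

End Smooth.

(* Tensor calculus in one chart.  Points, vectors and vector fields are
   row vectors, and a (0,2)-tensor T acts by T(u, v) = u T v^T. *)
Section LocalGeometry.
Context {R : realType} {n : nat}.
Local Notation E := 'rV[R]_n.

Definition basis_vec (i : 'I_n) : E := delta_mx 0 i.

Definition bilin (T : 'M[R]_n) (u v : E) : R := (u *m T *m v^T) 0 0.

Definition bracket (X Y : E -> E) (x : E) : E := 'D_(X x) Y x - 'D_(Y x) X x.

(* (L_X T)(Y,Z) = X(T(Y,Z)) - T([X,Y],Z) - T(Y,[X,Z]) evaluated on the
   coordinate fields Y = d_i and Z = d_j. *)
Definition lie_derivative (X : E -> E) (T : E -> 'M[R]_n) (x : E) : 'M[R]_n :=
  \matrix_(i, j)
    ('D_(X x) (fun y => bilin (T y) (basis_vec i) (basis_vec j)) x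
     - bilin (T x) (bracket X (cst (basis_vec i)) x) (basis_vec j)
     - bilin (T x) (basis_vec i) (bracket X (cst (basis_vec j)) x)).

Section Connection.
Variable g : E -> 'M[R]_n.

Definition dmetric (l i j : 'I_n) (x : E) : R :=
  'D_(basis_vec l) (fun y => g y i j) x.

(* [christoffel i j k x] is Gamma^k_ij at x; the lemmas below check that these
   coefficients are those of the torsion-free metric connection. *)
Definition christoffel (i j k : 'I_n) (x : E) : R :=
  2^-1 * \sum_l invmx (g x) k l *
    (dmetric i j l x + dmetric j i l x - dmetric l i j x).

Definition cov (u : E) (Y : E -> E) (x : E) : E :=
  'D_u Y x + \row_k \sum_i \sum_j u 0 i * Y x 0 j * christoffel i j k x.

Definition nabla (X Y : E -> E) (x : E) : E := cov (X x) Y x.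

Definition riemann (X Y Z : E -> E) (x : E) : E :=
  nabla X (nabla Y Z) x - nabla Y (nabla X Z) x - nabla (bracket X Y) Z x.

(* Curvature is tensorial, so the tangent vectors u and v are extended by the
   fields with constant components. *)
Definition sectional (u v : E) (x : E) : R :=
  bilin (g x) (riemann (cst u) (cst v) (cst v) x) u /
  (bilin (g x) u u * bilin (g x) v v - bilin (g x) u v ^+ 2).

Lemma dmetric_sym (l i j : 'I_n) (x : E) :
  (\forall y \near x, (g y)^T = g y) -> dmetric l i j x = dmetric l j i x.
Proof.
move=> gs; apply: near_eq_derive.
by apply: filterS gs => y gy; rewrite -[in LHS]gy mxE.
Qed.

Lemma christoffel_torsion_free (i j k : 'I_n) (x : E) :
  (\forall y \near x, (g y)^T = g y) ->
  christoffel i j k x = christoffel j i k x.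
Proof.
move=> gs; rewrite /christoffel; congr (_ * _); apply: eq_bigr => l _.
by rewrite (dmetric_sym l i j gs) [dmetric i j l x + _]addrC.
Qed.

Lemma christoffel_lower (i j m : 'I_n) (x : E) :
  (g x)^T = g x -> g x \in unitmx ->
  \sum_k christoffel i j k x * g x k m =
  2^-1 * (dmetric i j m x + dmetric j i m x - dmetric m i j x).
Proof.
move=> gs gu.
under eq_bigr do rewrite /christoffel -mulrA.
rewrite -mulr_sumr; congr (_ * _).
under eq_bigr do rewrite mulr_suml.
rewrite exchange_big /= (bigD1 m) //= [X in _ + X]big1 ?addr0; last first.
  move=> l /negPf lm.
  have := mulmxV gu => /matrixP/(_ m l); rewrite !mxE eq_sym lm /= => h.
  transitivity (0 * (dmetric i j l x + dmetric j i l x - dmetric l i j x)).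
    rewrite -[X in _ = X * _]h mulr_suml; apply: eq_bigr => k _.
    by rewrite mulrAC -[in LHS]gs mxE [_ * g x m k]mulrC gs.
  by rewrite mul0r.
have := mulmxV gu => /matrixP/(_ m m); rewrite !mxE eqxx /= => h.
rewrite -[RHS]mul1r -[X in _ = X * _]h mulr_suml; apply: eq_bigr => k _.
by rewrite mulrAC -[in LHS]gs mxE [_ * g x m k]mulrC gs.
Qed.

Lemma christoffel_metric (l i j : 'I_n) (x : E) :
  (\forall y \near x, (g y)^T = g y) -> g x \in unitmx ->
  dmetric l i j x =
  \sum_k christoffel l i k x * g x k j + \sum_k christoffel l j k x * g x i k.
Proof.
move=> gs gu; have gsx := nbhs_singleton gs.
under [X in _ + X]eq_bigr do rewrite -[in X in _ * X]gsx mxE.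
rewrite !christoffel_lower //.
rewrite (dmetric_sym l j i gs).
by field.
Qed.

End Connection.
End LocalGeometry.

(* A set of points with an atlas; [chart_inv i] is the inverse of the chart
   [chart_map i : chart_dom i -> R^mdim], and both have arbitrary values outside
   their domains. *)
Record atlas_space (R : realType) := AtlasSpace {
  mpoint :> topologicalType;
  mdim : nat;
  chart : Type;
  chart_dom : chart -> set mpoint;
  chart_map : chart -> mpoint -> 'rV[R]_mdim;
  chart_inv : chart -> 'rV[R]_mdim -> mpoint }.

Arguments AtlasSpace {R}.
Arguments mdim {R}.
Arguments chart {R}.
Arguments chart_dom {R M} : rename.
Arguments chart_map {R M} : rename.
Arguments chart_inv {R M} : rename.

Section Manifold.
Context {R : realType}.

Definition chart_img (M : atlas_space R) (i : chart M) : set 'rV[R]_(mdim M) :=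
  chart_map i @` chart_dom i.

Definition transition (M : atlas_space R) (i j : chart M) :
    'rV[R]_(mdim M) -> 'rV[R]_(mdim M) :=
  chart_map j \o chart_inv i.

Definition overlap (M : atlas_space R) (i j : chart M) : set 'rV[R]_(mdim M) :=
  chart_map i @` (chart_dom i `&` chart_dom j).

Definition is_chart (M : atlas_space R) (i : chart M) : Prop :=
  [/\ open (chart_dom i), open (chart_img i),
      (forall p, chart_dom i p -> chart_inv i (chart_map i p) = p),
      {within chart_dom i, continuous (chart_map i)} &
      {within chart_img i, continuous (chart_inv i)}].

Definition is_smooth_manifold (M : atlas_space R) : Prop :=
  [/\ hausdorff_space M, @second_countable M,
      (forall p : M, exists i : chart M, chart_dom i p),
      (forall i : chart M, is_chart i) &
      (forall i j : chart M, smooth_on (overlap i j) (transition i j))].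

Definition smooth_function (M : atlas_space R) (f : M -> R) : Prop :=
  forall i : chart M, smooth_on (chart_img i) (f \o chart_inv i).

(* Tensor fields are given by their components in every chart, as functions of
   the coordinates, subject to the transformation law; only the values on
   [chart_img i] are meaningful. *)
Definition vector_comps (M : atlas_space R) : Type :=
  chart M -> 'rV[R]_(mdim M) -> 'rV[R]_(mdim M).

Definition is_vector_field (M : atlas_space R) (X : vector_comps M) : Prop :=
  (forall i, smooth_on (chart_img i) (X i)) /\
  (forall i j x, overlap i j x ->
     X j (transition i j x) = 'D_(X i x) (transition i j) x).

Definition metric_comps (M : atlas_space R) : Type :=
  chart M -> 'rV[R]_(mdim M) -> 'M[R]_(mdim M).

Definition is_riemannian_metric (M : atlas_space R) (g : metric_comps M) :
    Prop :=
  [/\ (forall i, smooth_on (chart_img i) (g i)),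
      (forall i x, chart_img i x -> (g i x)^T = g i x),
      (forall i x u, chart_img i x -> u != 0 -> 0 < bilin (g i x) u u) &
      (forall i j x u v, overlap i j x ->
         bilin (g i x) u v =
         bilin (g j (transition i j x))
           ('D_u (transition i j) x) ('D_v (transition i j) x))].

Definition nontrivial_field (M : atlas_space R) (X : vector_comps M) : Prop :=
  exists i x, chart_img i x /\ X i x != 0.

Definition two_killing (M : atlas_space R) (g : metric_comps M)
    (X : vector_comps M) : Prop :=
  forall i x, chart_img i x ->
    lie_derivative (X i) (lie_derivative (X i) (g i)) x = 0.

Definition smooth_curve (M : atlas_space R) (J : set R) (c : R -> M) : Prop :=
  [/\ open J, is_interval J, {within J, continuous c} &
      forall i : chart M,
        smooth_on (J `&` c @^-1` chart_dom i) (chart_map i \o c)].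

Definition velocity (M : atlas_space R) (c : R -> M) (i : chart M) (t : R) :
    'rV[R]_(mdim M) :=
  derive1 (chart_map i \o c) t.

Definition cov_field (M : atlas_space R) (g : metric_comps M)
    (X Y : vector_comps M) : vector_comps M :=
  fun i => nabla (g i) (X i) (Y i).

Definition parallel_along (M : atlas_space R) (g : metric_comps M)
    (Y : vector_comps M) (J : set R) (c : R -> M) : Prop :=
  forall t, J t -> forall i, chart_dom i (c t) ->
    cov (g i) (velocity c i t) (Y i) (chart_map i (c t)) = 0.

Definition product (M1 M2 : atlas_space R) : atlas_space R :=
  AtlasSpace (M1 * M2)%type (mdim M1 + mdim M2) (chart M1 * chart M2)%type
    (fun i => chart_dom i.1 `*` chart_dom i.2)
    (fun i p => row_mx (chart_map i.1 p.1) (chart_map i.2 p.2))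
    (fun i x => (chart_inv i.1 (lsubmx x), chart_inv i.2 (rsubmx x))).

Definition warped_metric (M1 M2 : atlas_space R) (f : M1 -> R)
    (g1 : metric_comps M1) (g2 : metric_comps M2) :
    metric_comps (product M1 M2) :=
  fun i x => block_mx (g1 i.1 (lsubmx x)) 0 0
    (f (chart_inv i.1 (lsubmx x)) ^+ 2 *: g2 i.2 (rsubmx x)).

Lemma warped_metricE (M1 M2 : atlas_space R) (f : M1 -> R)
    (g1 : metric_comps M1) (g2 : metric_comps M2)
    (i : chart (product M1 M2)) (x : 'rV[R]_(mdim M1 + mdim M2))
    (u1 v1 : 'rV[R]_(mdim M1)) (u2 v2 : 'rV[R]_(mdim M2)) :
  bilin (warped_metric f g1 g2 i x) (row_mx u1 u2) (row_mx v1 v2) =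
  bilin (g1 i.1 (lsubmx x)) u1 v1 +
  f (chart_inv i.1 (lsubmx x)) ^+ 2 * bilin (g2 i.2 (rsubmx x)) u2 v2.
Proof.
rewrite /bilin /warped_metric mul_row_block !mulmx0 addr0 add0r.
by rewrite tr_row_mx mul_row_col -scalemxAr -scalemxAl !mxE.
Qed.

End Manifold.

(* Main.v *)
Require Import Defs.
From mathcomp Require Import all_boot all_order all_algebra.
From mathcomp Require Import all_classical all_reals all_analysis.
From mathcomp Require Import ring lra.

Set Implicit Arguments.
Unset Strict Implicit.
Unset Printing Implicit Defensive.

Import Order.TTheory GRing.Theory Num.Theory.
Import numFieldNormedType.Exports.

Local Open Scope classical_set_scope.
Local Open Scope ring_scope.

(** The inequality is local.  In a chart let [omega_u] be the connection matrix
    in the direction [u], so that [D_u g = omega_u g + g omega_u^T] and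
    [w omega_u = u omega_w], and put [N = omega_zeta + D zeta], so that
    [v N = nabla_v zeta].  Then [L_zeta g = N g + g N^T], and differentiating once
    more gives, using the equality of mixed partial derivatives,
    [v (L_zeta L_zeta g) v^T / 2 =
       g(R(zeta, v) zeta, v) + g(nabla_v nabla_zeta zeta, v) + |nabla_v zeta|^2].
    For a 2-Killing field and [nabla_v nabla_zeta zeta = 0] the numerator
    [g(R(zeta, v) v, zeta)] of the sectional curvature is therefore
    [|nabla_v zeta|^2], and its denominator is nonnegative by Cauchy-Schwarz. *)

(** * Directional derivatives of real functions and symmetry of second derivatives *)

Section DirectionalDerivatives.
Context {R : realType} {V : normedModType R}.
Implicit Types (f : V -> R) (x u v w : V).

Lemma is_derive_line f x w (s : R) : derivable f (x + s *: w) w ->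
  is_derive s 1 (fun t => f (x + t *: w)) ('D_w f (x + s *: w)).
Proof.
have E : (fun h : R => h^-1 *: (((fun t : R => f (x + t *: w)) \o shift s) (h *: (1 : R))
            - f (x + s *: w))) =
         (fun h => h^-1 *: ((f \o shift (x + s *: w)) (h *: w) - f (x + s *: w))).
  apply/funext => h /=; congr (_ *: (f _ - _)).
  by rewrite -[h *: 1]/(h * 1) mulr1 scalerDl addrCA.
by move=> d; split; rewrite /derivable /derive E.
Qed.

(** Only the restriction of [f] to the line through [x] along [v] matters: a derivable function of
    one real variable is differentiable, and its differential at 0 is linear. *)
Lemma is_derive_dirZ f x v (a : R) : derivable f x v ->
  is_derive x (a *: v) f (a * 'D_v f x).
Proof.
move=> d.
have E b w : (fun h : R => h^-1 *: ((f \o shift x) (h *: (b *: w)) - f x)) =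
  (fun h => h^-1 *: (((fun t : R => f (x + t *: w)) \o shift 0) (h *: (b : R))
            - f (x + 0 *: w))).
  apply/funext => h /=; congr (_ *: (f _ - f _)); last by rewrite scale0r addr0.
  by rewrite addr0 [h *: b]/(h * b) scalerA addrC.
have d0 : derivable f (x + 0 *: v) v by rewrite scale0r addr0.
have [d1 e1] := is_derive_line d0.
have dd : differentiable (fun t : R => f (x + t *: v)) 0 by apply/derivable1_diffP.
split; first by rewrite /derivable E; exact: (@diff_derivable _ _ _ _ _ a dd).
have -> : 'D_(a *: v) f x = 'D_a (fun t : R => f (x + t *: v)) 0.
  by rewrite [LHS]/derive E.
rewrite (deriveE _ dd).
move: e1; rewrite (deriveE _ dd) scale0r addr0 => <-.
have -> : 'd (fun t : R => f (x + t *: v)) 0 a =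
    'd (fun t : R => f (x + t *: v)) 0 (a *: (1 : R^o)).
  by rewrite -[a *: _]/(a * 1) mulr1.
by rewrite linearZ.
Qed.

(** Parametrising the segment by [0, 1] treats every sign of [h] alike. *)
Lemma MVT_line f x w (h : R) :
  (forall s : R, 0 <= s <= 1 -> derivable f (x + s *: (h *: w)) w) ->
  exists2 s : R, 0 <= s <= 1 &
    f (x + h *: w) - f x = h * 'D_w f (x + s *: (h *: w)).
Proof.
move=> d; have dh s (s01 : 0 <= s <= 1) := is_derive_dirZ h (d s s01).
have dl s (s01 : 0 <= s <= 1) := is_derive_line (@ex_derive _ _ _ _ _ _ _ (dh s s01)).
have [|s||s] := @MVT_segment R (fun t => f (x + t *: (h *: w)))
   (fun t => 'D_(h *: w) f (x + t *: (h *: w))) 0 1; first exact: ler01.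
- by rewrite in_itv => /andP[s0 s1]; apply: dl; rewrite !ltW.
- apply: derivable_within_continuous => s; rewrite in_itv => s01.
  by have [] := dl _ s01.
rewrite in_itv => s01; rewrite scale1r scale0r addr0 subr0 mulr1 => e.
by exists s => //; rewrite e (@derive_val _ _ _ _ _ _ _ (dh s s01)).
Qed.

(** A point of the parallelogram with sides [h *: u] and [h *: v] is at distance at most |h| (|u| +
    |v|) from [x], so a small [h] serves all [s] and [t] at once. *)
Lemma near0_scale_dir (P : V -> Prop) x u v : (\forall y \near x, P y) ->
  \forall h \near (0 : R), forall s t : R, 0 <= s <= 1 -> 0 <= t <= 1 ->
    P (x + s *: (h *: u) + t *: (h *: v)).
Proof.
move=> /nbhs_ballP[e /= e0 eP].
(* The summand 1 keeps the divisor positive when [u] and [v] both vanish. *)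
have K0 : 0 < `|u| + `|v| + 1 by rewrite ltr_wpDl ?addr_ge0.
apply/nbhs_ballP; exists (e / (`|u| + `|v| + 1)) => /=; first exact: divr_gt0.
move=> h /=; rewrite -ball_normE /ball_ /= sub0r normrN => hs s t s01 t01.
apply: eP; rewrite -ball_normE /ball_ /= -addrA opprD addNKr normrN.
apply: le_lt_trans (ler_normD _ _) _; rewrite !normrZ.
have [s0 s1] := andP s01; have [t0 t1] := andP t01.
rewrite (ger0_norm s0) (ger0_norm t0).
move: hs; rewrite ltr_pdivlMr //; apply: le_lt_trans.
have := normr_ge0 u; have := normr_ge0 v; have := normr_ge0 h.
move: `|u| `|v| `|h| => a b c c0 b0 a0.
have := ler_piMl (mulr_ge0 c0 a0) s1; have := ler_piMl (mulr_ge0 c0 b0) t1.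
by rewrite !mulrDr; lra.
Qed.

(** Move first by [h *: u], then by [h *: v]. By the mean value theorem the second increment is [h]
    times ['D_v f] at a point tending to [x], where ['D_v f] is continuous. *)
Lemma is_derive_dirD f x u v : derivable f x u ->
  (\forall y \near x, derivable f y v) -> {for x, continuous ('D_v f)} ->
  is_derive x (u + v) f ('D_u f x + 'D_v f x).
Proof.
move=> du dv cv.
suff cvg : (fun h : R => h^-1 *: ((f \o shift x) (h *: (u + v)) - f x)) @ 0^'
    --> 'D_u f x + 'D_v f x.
  by split; [apply/cvg_ex; eexists; exact: cvg | exact: cvg_lim cvg].
apply/cvgrPdist_le => e e0.
have e2 : 0 < e / 2 by rewrite divr_gt0.
have/cvgrPdist_le/(_ _ e2) A := du.
have dvC : \forall y \near x, derivable f y v /\ `|'D_v f x - 'D_v f y| <= e / 2.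
  by apply: filterI => //; exact: (cvgrPdist_le _ _).1 cv _ e2.
have B := near0_scale_dir u v dvC.
have := nbhs_dnbhs B; apply: filter_app; near=> h => Bh.
have h0 : h != 0 by near: h; exact: nbhs_dnbhs_neq.
have Ah : `|'D_u f x - h^-1 *: ((f \o shift x) (h *: u) - f x)| <= e / 2.
  by near: h.
have o1 : 0 <= (1 : R) <= 1 by rewrite ler01 lexx.
have dl s : 0 <= s <= 1 -> derivable f (x + h *: u + s *: (h *: v)) v.
  by move=> s01; have [] := Bh 1 s o1 s01; rewrite scale1r.
have [s s01 E] := MVT_line dl.
have [_] := Bh 1 s o1 s01; rewrite scale1r => Bs.
move: Ah E; rewrite /= [h *: (u + v)]scalerDr [h *: u + x]addrC.
rewrite [h *: u + h *: v + x]addrC addrA.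
move=> Ah E.
have -> : f (x + h *: u + h *: v) - f x = 
  (f (x + h *: u) - f x) + h * 'D_v f (x + h *: u + s *: (h *: v)).
  by rewrite -E [RHS]addrC subrKA.
rewrite scalerDr -[h^-1 *: (h * _)]/(h^-1 * (h * _)) mulKf // opprD addrACA.
by rewrite (splitr e); apply: le_trans (ler_normD _ _) (lerD _ _).
Unshelve. all: by end_near. Qed.

(** Two applications of the mean value theorem: along [u] to [y |-> f (y + h *: v) - f y], then
    along [v] to ['D_u f]. *)
Lemma second_difference f x u v (h : R) :
  (forall s t : R, 0 <= s <= 1 -> 0 <= t <= 1 ->
    derivable f (x + s *: (h *: u) + t *: (h *: v)) u /\
    derivable ('D_u f) (x + s *: (h *: u) + t *: (h *: v)) v) ->
  exists s t : R, [/\ 0 <= s <= 1, 0 <= t <= 1 &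
    f (x + h *: u + h *: v) - f (x + h *: u) - (f (x + h *: v) - f x) =
    h * (h * 'D_v ('D_u f) (x + s *: (h *: u) + t *: (h *: v)))].
Proof.
move=> d.
have o1 : 0 <= (1 : R) <= 1 by rewrite ler01 lexx.
have o0 : 0 <= (0 : R) <= 1 by rewrite ler01 lexx.
pose g y := f (y + h *: v) - f y.
have shiftE y : derivable f (y + h *: v) u ->
    is_derive y u (fun z => f (z + h *: v)) ('D_u f (y + h *: v)).
  have E : (fun k : R => k^-1 *: (((fun z => f (z + h *: v)) \o shift y) (k *: u)
      - f (y + h *: v))) =
      (fun k : R => k^-1 *: ((f \o shift (y + h *: v)) (k *: u) - f (y + h *: v))).
    by apply/funext => k /=; rewrite addrA.
  by move=> ?; split; rewrite /derivable /derive E.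
have dg s : 0 <= s <= 1 -> is_derive (x + s *: (h *: u)) u g
    ('D_u f (x + s *: (h *: u) + h *: v) - 'D_u f (x + s *: (h *: u))).
  move=> s01; apply: is_deriveB.
    by apply: shiftE; have := (d s 1 s01 o1).1; rewrite scale1r; exact.
  by apply: derivableP; have := (d s 0 s01 o0).1; rewrite scale0r addr0; exact.
have [s s01] := MVT_line (fun s s01 => @ex_derive _ _ _ _ _ _ _ (dg s s01)).
rewrite (@derive_val _ _ _ _ _ _ _ (dg s s01)) /g => ->.
have [t t01 ->] := MVT_line (fun t t01 => (d s t s01 t01).2).
by exists s, t.
Qed.

(** The points of agreement lie in parallelograms that shrink to [x] with [h], so continuity gives
    |F x - G x| <= e for every e > 0. *)
Lemma near0_meet_eq (F G : V -> R) x u v :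
  {for x, continuous F} -> {for x, continuous G} ->
  (\forall h \near (0 : R)^', exists s t s' t' : R,
    [/\ 0 <= s <= 1, 0 <= t <= 1, 0 <= s' <= 1 & 0 <= t' <= 1] /\
    F (x + s *: (h *: u) + t *: (h *: v)) =
    G (x + s' *: (h *: v) + t' *: (h *: u))) ->
  F x = G x.
Proof.
move=> cF cG FG; apply/eqP; rewrite -subr_eq0 -normr_le0; apply/ler_addgt0Pl => e e0.
rewrite addr0.
have e2 : 0 < e / 2 by rewrite divr_gt0.
have nF : \forall y \near x, `|F x - F y| <= e / 2.
  exact: (cvgrPdist_le _ _).1 cF _ e2.
have nG : \forall y \near x, `|G x - G y| <= e / 2.
  exact: (cvgrPdist_le _ _).1 cG _ e2.
have BF := near0_scale_dir u v nF; have BG := near0_scale_dir v u nG.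
have : \forall h \near (0 : R)^', `|F x - G x| <= e.
  have := FG; have := nbhs_dnbhs BG; have := nbhs_dnbhs BF.
  apply: filter_app3; near=> h => B1 B2 [s [t [s' [t' [[s01 t01 s'01 t'01] E]]]]].
  have := B1 s t s01 t01; have := B2 s' t' s'01 t'01; rewrite E.
  set q := G (_ + _) => G1 F1; rewrite -(subrK q (F x)) -addrA (splitr e).
  by apply: le_trans (ler_normD _ _) (lerD F1 _); rewrite distrC.
by move=> /filter_ex[].
Unshelve. all: by end_near. Qed.

(** Schwarz's theorem. The second difference of [f] is symmetric in [u] and [v]; evaluated in both
    orders it makes the mixed derivatives agree at points tending to [x]. *)
Lemma derive_comm f x u v :
  (\forall y \near x, [/\ derivable f y u, derivable f y v,
     derivable ('D_u f) y v & derivable ('D_v f) y u]) ->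
  {for x, continuous ('D_v ('D_u f))} -> {for x, continuous ('D_u ('D_v f))} ->
  'D_v ('D_u f) x = 'D_u ('D_v f) x.
Proof.
have key (a b c c' k p q : R) : k != 0 -> a - b - (c - c') = k * (k * p) ->
    a - c - (b - c') = k * (k * q) -> p = q.
  by move=> k0 e1 e2; do 2 apply: (mulfI k0); rewrite -e1 -e2; ring.
move=> d cvu cuv; apply: (near0_meet_eq cvu cuv (u := u) (v := v)).
have := nbhs_dnbhs (near0_scale_dir v u d); have := nbhs_dnbhs (near0_scale_dir u v d).
apply: filter_app2; near=> h => B1 B2.
have h0 : h != 0 by near: h; exact: nbhs_dnbhs_neq.
have [s t s01 t01|s [t [s01 t01]]] := @second_difference f x u v h.
  by have [d1 _ d2 _] := B1 s t s01 t01; exact: (conj d1 d2).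
have [s' t' s'01 t'01|s' [t' [s'01 t'01]]] := @second_difference f x v u h.
  by have [_ d1 _ d2] := B2 s' t' s'01 t'01; exact: (conj d1 d2).
rewrite [x + h *: v + h *: u]addrAC => E1 E2; exists s, t, s', t'; split; first by split.
exact: key h0 E2 E1.
Unshelve. all: by end_near. Qed.
End DirectionalDerivatives.

(** * Closure properties of C^k functions *)

Section Ck.
Context {R : realType} {V : normedModType R}.
Implicit Types (U : set V) (k : nat).

Lemma open_near U x : open U -> U x -> \forall y \near x, U y.
Proof. by move=> oU Ux; apply: open_nbhs_nbhs. Qed.

Lemma near_eq_continuous (W : normedModType R) (f g : V -> W) x :
  {near x, f =1 g} -> {for x, continuous f} -> {for x, continuous g}.
Proof.
move=> fg cf; rewrite /prop_for /continuous_at -(nbhs_singleton fg).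
exact: cvg_trans (near_eq_cvg fg) cf.
Qed.

Lemma Ck_onW (W : normedModType R) k U (f : V -> W) :
  Ck_on k.+1 U f -> Ck_on k U f.
Proof.
elim: k f => [|k IH] f [cf [df Df]]; split=> //; split=> // v.
by apply: IH; exact: Df.
Qed.

Lemma Ck_on_subset (W : normedModType R) k U U' (f : V -> W) :
  U `<=` U' -> Ck_on k U' f -> Ck_on k U f.
Proof.
move=> UU'; elim: k f => [|k IH] f [cf Df].
all: split; first by move=> x /UU'; exact: cf.
  by [].
by case: Df => df Df; split=> [v x /UU'|v]; [exact: df | exact: IH (Df v)].
Qed.

(** Openness of [U] turns equality on [U] into equality near each of its points, which derivatives
    inherit. *)
Lemma eq_Ck_on (W : normedModType R) k U (f g : V -> W) : open U ->
  {in U, f =1 g} -> Ck_on k U f -> Ck_on k U g.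
Proof.
move=> oU; elim: k f g => [|k IH] f g fg [cf Df].
all: have nfg x : U x -> {near x, f =1 g}.
1,3: by move=> Ux; apply: filterS (open_near oU Ux) => y /mem_set/fg.
all: split; first by move=> x Ux; exact: near_eq_continuous (nfg x Ux) (cf x Ux).
  by [].
case: Df => df Df; split=> [v x Ux|v].
  exact: near_eq_derivable (nfg x Ux) (df v x Ux).
apply: IH (Df v) => x /set_mem Ux; exact: near_eq_derive (nfg x Ux).
Qed.

Lemma Ck_on_entry m n k U (M : V -> 'M[R]_(m, n)) i j : open U ->
  Ck_on k U M -> Ck_on k U (fun x => M x i j).
Proof.
move=> oU; elim: k M => [|k IH] M [cM DM].
all: split; first by move=> x Ux;
  exact: (continuous_comp (cM x Ux) (@coord_continuous _ _ _ i j _)).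
  by [].
case: DM => dM DM; split=> [v x Ux|v].
  exact: (derivable_mxP _ _ _).1 (dM v x Ux) i j.
apply: eq_Ck_on (IH _ (DM v)) => // x /set_mem Ux.
by rewrite (derive_mx (dM v x Ux)) mxE.
Qed.

Lemma Ck_on_cst k U (a : R) : Ck_on k U (cst a).
Proof.
elim: k a => [|k IH] a.
all: split; first by move=> x _; exact: cvg_cst.
  by [].
split=> [v x _|v]; first exact: derivable_cst.
rewrite (_ : 'D_v _ = cst 0); first exact: IH.
by apply/funext => x; exact: derive_cst.
Qed.

Lemma Ck_onD k U (f g : V -> R) : open U ->
  Ck_on k U f -> Ck_on k U g -> Ck_on k U (f + g).
Proof.
move=> oU; elim: k f g => [|k IH] f g [cf Df] [cg Dg].
all: split; first by move=> x Ux; apply: continuousD; [exact: cf | exact: cg].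
  by [].
case: Df Dg => df Df [dg Dg]; split=> [v x Ux|v].
  by apply: derivableD; [exact: df | exact: dg].
apply: eq_Ck_on (IH _ _ (Df v) (Dg v)) => // x /set_mem Ux.
by rewrite deriveD; [| exact: df | exact: dg].
Qed.

Lemma Ck_onM k U (f g : V -> R) : open U ->
  Ck_on k U f -> Ck_on k U g -> Ck_on k U (f * g).
Proof.
move=> oU; elim: k f g => [|k IH] f g Cf Cg; have [cf Df] := Cf; have [cg Dg] := Cg.
all: split; first by move=> x Ux; apply: continuousM; [exact: cf | exact: cg].
  by [].
case: Df Dg => df Df [dg Dg]; split=> [v x Ux|v].
  by apply: derivableM; [exact: df | exact: dg].
apply: eq_Ck_on (Ck_onD _ (IH _ _ (Ck_onW Cf) (Dg v)) (IH _ _ (Ck_onW Cg) (Df v))) => //.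
move=> x /set_mem Ux.
by rewrite deriveM; [| exact: df | exact: dg].
Qed.

(** For linear [L] the difference quotients of [f \o L] along [v] are those of [f] along [L v]. This
    pulls functions back from the factors of a product chart. *)
Lemma Ck_on_comp_linear (V' W : normedModType R) (L : {linear V' -> V}) k U
    (f : V -> W) : continuous L -> Ck_on k U f -> Ck_on k (L @^-1` U) (f \o L).
Proof.
move=> cL; elim: k f => [|k IH] f [cf Df].
all: split; first by move=> x Ux; exact: (continuous_comp (cL x) (cf _ Ux)).
  by [].
have E (x v : V') : (fun h : R => h^-1 *: (((f \o L) \o shift x) (h *: v) - (f \o L) x)) =
    (fun h => h^-1 *: ((f \o shift (L x)) (h *: L v) - f (L x))).
  by apply/funext => h /=; congr (_ *: (f _ - _)); rewrite linearD linearZZ.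
case: Df => df Df; split=> [v x Ux|v]; first by rewrite /derivable E; exact: df.
rewrite (_ : 'D_v (f \o L) = 'D_(L v) f \o L); first exact: IH (Df (L v)).
by apply/funext => x; rewrite /derive E.
Qed.

End Ck.

(** * Coordinate expressions of derivatives *)

Section CoordinateDerivatives.
Context {R : realType} {n : nat}.
Local Notation E := 'rV[R]_n.

Lemma C1_derive_coord (U : set E) (f : E -> R) x w : open U -> Ck_on 1 U f ->
  U x -> 'D_w f x = \sum_i w 0 i * 'D_(basis_vec i) f x.
Proof.
move=> oU [cf [df Df]] Ux.
rewrite {1}[w]row_sum_delta.
suff [] : is_derive x (\sum_i w 0 i *: basis_vec i) f
    (\sum_i w 0 i * 'D_(basis_vec i) f x) by [].
elim/big_rec2: _ => [|i a v _ H]; first exact: is_derive0.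
have dZ y : U y -> is_derive y (w 0 i *: basis_vec i) f (w 0 i * 'D_(basis_vec i) f y).
  by move=> Uy; exact/is_derive_dirZ/df.
have d1 : \forall y \near x, derivable f y (w 0 i *: basis_vec i).
  exact: filterS (df (w 0 i *: basis_vec i)) (open_near oU Ux).
have c1 := (Df (w 0 i *: basis_vec i)).1 x Ux.
(* The partial sum must be the first direction in [is_derive_dirD]: its derivative is known at [x]
   only, while the coordinate direction has a continuous derivative on [U]. *)
rewrite [_ + a]addrC [_ + v]addrC.
have [dH <-] := H; have [_ <-] := dZ x Ux.
exact: is_derive_dirD dH d1 c1.
Qed.

Lemma C2_derive_comm (U : set E) (f : E -> R) x u v : open U -> Ck_on 2 U f ->
  U x -> 'D_v ('D_u f) x = 'D_u ('D_v f) x.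
Proof.
move=> oU [cf [df Df]] Ux.
apply: derive_comm.
- apply: filterS (open_near oU Ux) => y Uy.
  have [_ [du _]] := Df u; have [_ [dv _]] := Df v.
  by split; [exact: df | exact: df | exact: du | exact: dv].
- exact: ((Df u).2.2 v).1 x Ux.
- exact: ((Df v).2.2 u).1 x Ux.
Qed.

End CoordinateDerivatives.

(** * Calculus of matrix-valued maps *)

Section MatrixDerivatives.
Context {R : realType} {V : normedModType R}.
Implicit Types x v : V.

Lemma derivable_sum_seq (I : Type) (r : seq I) (h : I -> V -> R) x v :
  (forall i, derivable (h i) x v) -> derivable (fun y => \sum_(i <- r) h i y) x v.
Proof.
move=> dh; elim: r => [|i r IH].
  under eq_fun do rewrite big_nil; exact: derivable_cst.
under eq_fun do rewrite big_cons; exact: derivableD (dh i) IH.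
Qed.

Lemma derivable_prod_seq (I : Type) (r : seq I) (h : I -> V -> R) x v :
  (forall i, derivable (h i) x v) -> derivable (fun y => \prod_(i <- r) h i y) x v.
Proof.
move=> dh; elim: r => [|i r IH].
  under eq_fun do rewrite big_nil; exact: derivable_cst.
under eq_fun do rewrite big_cons; exact: derivableM (dh i) IH.
Qed.

Lemma is_derive_sum_seq (I : Type) (r : seq I) (h : I -> V -> R) (dh : I -> R) x v :
  (forall i, is_derive x v (h i) (dh i)) ->
  is_derive x v (fun y => \sum_(i <- r) h i y) (\sum_(i <- r) dh i).
Proof.
move=> dh'; elim: r => [|i r IH].
  rewrite big_nil; under eq_fun do rewrite big_nil; exact: is_derive_cst.
rewrite big_cons; under eq_fun do rewrite big_cons; exact: is_deriveD (dh' i) IH.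
Qed.

Lemma is_derive_mx m n (A : V -> 'M[R]_(m, n)) (dA : 'M[R]_(m, n)) x v :
  (forall i j, is_derive x v (fun y => A y i j) (dA i j)) -> is_derive x v A dA.
Proof.
move=> d; have dA' : derivable A x v.
  by apply/derivable_mxP => i j; have [] := d i j.
split=> //; rewrite derive_mx //; apply/matrixP => i j; rewrite mxE.
by have [] := d i j.
Qed.

Lemma is_derive_entry m n (A : V -> 'M[R]_(m, n)) (dA : 'M[R]_(m, n)) x v i j :
  is_derive x v A dA -> is_derive x v (fun y => A y i j) (dA i j).
Proof.
move=> [d <-]; split; first exact: (derivable_mxP _ _ _).1 d i j.
by rewrite derive_mx // mxE.
Qed.

Lemma is_derive_mulr (f g : V -> R) (df dg : R) x v :
  is_derive x v f df -> is_derive x v g dg ->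
  is_derive x v (fun y => f y * g y) (df * g x + f x * dg).
Proof.
move=> hf hg; apply: (is_derive_eq (is_deriveM hf hg)).
by rewrite addrC; congr (_ + _); exact: mulrC.
Qed.

Lemma is_derive_mulmx m n p (A : V -> 'M[R]_(m, n)) (B : V -> 'M[R]_(n, p))
    dA dB x v : is_derive x v A dA -> is_derive x v B dB ->
  is_derive x v (fun y => A y *m B y) (dA *m B x + A x *m dB).
Proof.
move=> hA hB; apply: is_derive_mx => i j.
rewrite !mxE -big_split /=; under eq_fun do rewrite mxE.
apply: is_derive_sum_seq => k; apply: is_derive_mulr; exact: is_derive_entry.
Qed.

Lemma is_derive_trmx m n (A : V -> 'M[R]_(m, n)) dA x v : is_derive x v A dA ->
  is_derive x v (fun y => (A y)^T) dA^T.
Proof.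
move=> hA; apply: is_derive_mx => i j; rewrite mxE.
by under eq_fun do rewrite mxE; exact: is_derive_entry.
Qed.

Lemma derivable_det n (A : V -> 'M[R]_n) x v :
  (forall i j, derivable (fun y => A y i j) x v) ->
  derivable (fun y => \det (A y)) x v.
Proof.
move=> dA; apply: derivable_sum_seq => s; apply: derivableM.
  exact: derivable_cst.
by apply: derivable_prod_seq => i; exact: dA.
Qed.

(** Cramer's rule. Invertibility is asked near [x] because [invmx] returns its argument on singular
    matrices. *)
Lemma derivable_invmx n (A : V -> 'M[R]_n) x v i j :
  (\forall y \near x, A y \in unitmx) ->
  (forall i j, derivable (fun y => A y i j) x v) ->
  derivable (fun y => invmx (A y) i j) x v.
Proof.
move=> Au dA.
apply: (@near_eq_derivable _ _ _ (fun y => (\det (A y))^-1 * cofactor (A y) j i)).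
  by apply: filterS Au => y Ay; rewrite /invmx Ay !mxE.
apply: derivableM.
  apply: derivableV; last exact: derivable_det.
  by have := nbhs_singleton Au; rewrite unitmxE unitfE.
apply: derivableM; first exact: derivable_cst.
by apply: derivable_det => k l; under eq_fun do rewrite !mxE; exact: dA.
Qed.

End MatrixDerivatives.

(* With [A], [B] the connection matrices in two directions and [a], [b] their
   crossed derivatives, the right side is the commutator of the second
   derivatives of [g] computed from D_u g = omega_u g + g omega_u^T. *)
Lemma curvature_metric_identity (R : comNzRingType) n (A B a b g : 'M[R]_n) :
  (a - b + B *m A - A *m B) *m g + g *m (a - b + B *m A - A *m B)^T =
  a *m g + B *m (A *m g + g *m A^T) + (A *m g + g *m A^T) *m B^T + g *m a^T
  - (b *m g + A *m (B *m g + g *m B^T) + (B *m g + g *m B^T) *m A^T + g *m b^T).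
Proof.
rewrite !(raddfB, raddfD) /= !trmx_mul.
rewrite !(mulmxBl, mulmxBr, mulmxDl, mulmxDr) !mulmxA.
apply/matrixP => i j; rewrite !mxE.
by ring.
Qed.

(** * Connection and curvature in one chart, in matrix form *)

Section LocalFormulas.
Context {R : realType} {n : nat}.
Local Notation E := 'rV[R]_n.
Implicit Types (g : E -> 'M[R]_n) (Z : E -> E) (x y u v w : E).

(** Acts on row vectors from the right, so the row index belongs to the differentiated field. *)
Definition conn_mx g u y : 'M[R]_n :=
  \matrix_(j, k) \sum_i u 0 i * christoffel g i j k y.

(** Transposed Jacobian, so that [w *m jac_mx Z y] is the derivative of [Z] along [w]. *)
Definition jac_mx Z y : 'M[R]_n :=
  \matrix_(i, j) 'D_(basis_vec i) (fun y => Z y 0 j) y.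

Lemma mul_conn_mxE g u v y k :
  (v *m conn_mx g u y) 0 k = \sum_i \sum_j u 0 i * v 0 j * christoffel g i j k y.
Proof.
rewrite exchange_big mxE; apply: eq_bigr => j _; rewrite mxE mulr_sumr.
by apply: eq_bigr => i _; ring.
Qed.

Lemma covE g u Z y : cov g u Z y = 'D_u Z y + Z y *m conn_mx g u y.
Proof.
rewrite /cov; congr (_ + _); apply/rowP => k.
by rewrite mul_conn_mxE mxE.
Qed.

Section Chart.
Variables (g : E -> 'M[R]_n) (U : set E).
Hypotheses (oU : open U) (gC2 : forall i j, Ck_on 2 U (fun y => g y i j)).
Hypotheses (g_sym : forall y, U y -> (g y)^T = g y).
Hypotheses (g_unit : forall y, U y -> g y \in unitmx).

Let near_sym y : U y -> \forall z \near y, (g z)^T = g z.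
Proof. by move=> Uy; apply: filterS (open_near oU Uy) => z /g_sym. Qed.

(** Torsion-freeness: the Christoffel symbols are symmetric in their lower indices. *)
Lemma conn_mx_sym u w y : U y -> w *m conn_mx g u y = u *m conn_mx g w y.
Proof.
move=> Uy; apply/rowP => k; rewrite !mul_conn_mxE exchange_big.
apply: eq_bigr => j _; apply: eq_bigr => i _.
by rewrite (christoffel_torsion_free _ _ _ (near_sym Uy)) [u _ _ * _]mulrC.
Qed.

Lemma derivable_christoffel i j k y w : U y -> derivable (christoffel g i j k) y w.
Proof.
move=> Uy; apply: derivableM; first exact: derivable_cst.
have dd l a b : derivable (dmetric g l a b) y w.
  by have [_ [_ /(_ (basis_vec l))[_ [d _]]]] := gC2 a b; exact: d.
apply: derivable_sum_seq => l; apply: derivableM; last first.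
  by apply: derivableB; first apply: derivableD.
apply: derivable_invmx; first by apply: filterS (open_near oU Uy) => z /g_unit.
by move=> a b; have [_ [d _]] := gC2 a b; exact: d.
Qed.

(** Metric compatibility, extended from coordinate directions to [u] by linearity. *)
Lemma is_derive_metric u y : U y ->
  is_derive y u g (conn_mx g u y *m g y + g y *m (conn_mx g u y)^T).
Proof.
move=> Uy; apply: is_derive_mx => i j.
have C1 := Ck_onW (gC2 i j); have [_ [d _]] := C1.
split; first exact: d.
rewrite (C1_derive_coord _ oU C1 Uy) !mxE -big_split /=.
transitivity (\sum_l u 0 l * \sum_k (christoffel g l i k y * g y k j
    + christoffel g l j k y * g y i k)).
  apply: eq_bigr => l _; congr (_ * _); rewrite big_split /=.
  exact: christoffel_metric (near_sym Uy) (g_unit Uy).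
under [LHS]eq_bigr do rewrite mulr_sumr.
rewrite exchange_big; apply: eq_bigr => k _ /=.
rewrite !mxE mulr_suml mulr_sumr -big_split /=; apply: eq_bigr => l _.
by ring.
Qed.

Definition dconn_mx u v y : 'M[R]_n :=
  \matrix_(j, k) \sum_i u 0 i * 'D_v (christoffel g i j k) y.

(** The connection matrix is linear in its direction, so by the product rule the moving direction
    [Z] contributes [conn_mx g dZ y]. *)
Lemma is_derive_conn_mx_field Z (dZ : E) v y : U y -> is_derive y v Z dZ ->
  is_derive y v (fun z => conn_mx g (Z z) z) (conn_mx g dZ y + dconn_mx (Z y) v y).
Proof.
move=> Uy hZ; apply: is_derive_mx => j k.
rewrite !mxE -big_split /=; under eq_fun do rewrite mxE.
apply: is_derive_sum_seq => i; apply: is_derive_mulr; first exact: is_derive_entry.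
exact/derivableP/derivable_christoffel.
Qed.

Lemma is_derive_conn_mx u v y : U y -> is_derive y v (conn_mx g u) (dconn_mx u v y).
Proof.
move=> Uy; apply: is_derive_eq (is_derive_conn_mx_field Uy (is_derive_cst u y v)) _.
rewrite -[RHS]add0r; congr (_ + _).
by apply/matrixP => j k; rewrite !mxE big1 // => i _; rewrite mxE mul0r.
Qed.

Lemma dconn_mx_sym u v w y : U y -> w *m dconn_mx u v y = u *m dconn_mx w v y.
Proof.
move=> Uy.
have D (a b : E) : is_derive y v (fun z => b *m conn_mx g a z) (b *m dconn_mx a v y).
  apply: is_derive_eq (is_derive_mulmx (is_derive_cst b y v) (is_derive_conn_mx a v Uy)) _.
  by rewrite mul0mx add0r.
have [_ <-] := D u w; have [_ <-] := D w u.
by apply: near_eq_derive; apply: filterS (open_near oU Uy) => z; exact: conn_mx_sym.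
Qed.


(** The curvature operator: [w *m curv_mx u v y] is R(u, v) w. The products come in reversed order
    because matrices act from the right. *)
Definition curv_mx u v y : 'M[R]_n := dconn_mx v u y - dconn_mx u v y +
  conn_mx g v y *m conn_mx g u y - conn_mx g u y *m conn_mx g v y.

Lemma riemann_cst u v y : U y ->
  riemann g (cst u) (cst v) (cst v) y = v *m curv_mx u v y.
Proof.
move=> Uy.
have nab a b : nabla g (cst a) (cst b) = fun z => b *m conn_mx g a z.
  by apply/funext => z; rewrite /nabla covE derive_cst add0r.
have D (a b : E) : 'D_b (fun z => v *m conn_mx g a z) y = v *m dconn_mx a b y.
  have [_ ->] := is_derive_mulmx (is_derive_cst v y b) (is_derive_conn_mx a b Uy).
  by rewrite mul0mx add0r.
have con0 : conn_mx g 0 y = 0.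
  by apply/matrixP => j k; rewrite !mxE big1 // => i _; rewrite mxE mul0r.
have nab0 : nabla g (bracket (cst u) (cst v)) (cst v) y = 0.
  by rewrite /nabla /bracket !derive_cst subrr covE derive0 con0 mulmx0 addr0.
rewrite /riemann nab0 subr0 !nab /nabla !covE !D /curv_mx.
by rewrite mulmxBr mulmxDr mulmxBr !mulmxA opprD addrACA addrA.
Qed.

Lemma is_derive_derive_metric u v y : U y ->
  is_derive y v ('D_u g)
    (dconn_mx u v y *m g y + conn_mx g u y *m
       (conn_mx g v y *m g y + g y *m (conn_mx g v y)^T)
     + (conn_mx g v y *m g y + g y *m (conn_mx g v y)^T) *m (conn_mx g u y)^T
     + g y *m (dconn_mx u v y)^T).
Proof.
move=> Uy.
have E : \forall z \near y, conn_mx g u z *m g z + g z *m (conn_mx g u z)^T = 'D_u g z.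
  by apply: filterS (open_near oU Uy) => z Uz; have [_ ->] := is_derive_metric u Uz.
apply: near_eq_is_derive E _.
have Dg := is_derive_metric v Uy; have Dc := is_derive_conn_mx u v Uy.
apply: is_derive_eq (is_deriveD (is_derive_mulmx Dc Dg)
  (is_derive_mulmx Dg (is_derive_trmx Dc))) _.
by rewrite !addrA.
Qed.

(** R(u, v) is skew for [g]: second derivatives of [g] along [u] and [v] commute, and
    [curvature_metric_identity] identifies their commutator with the left side. *)
Lemma curv_mx_antisym u v y : U y ->
  curv_mx u v y *m g y + g y *m (curv_mx u v y)^T = 0.
Proof.
move=> Uy; have [_ Euv] := is_derive_derive_metric u v Uy.
have [_ Evu] := is_derive_derive_metric v u Uy.
have : 'D_u ('D_v g) y - 'D_v ('D_u g) y = 0.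
  apply/eqP; rewrite subr_eq0; apply/eqP/matrixP => i j.
  have [duv _] := is_derive_derive_metric u v Uy.
  have [dvu _] := is_derive_derive_metric v u Uy.
  have ent (a b : E) : derivable ('D_a g) y b ->
      ('D_b ('D_a g) y) i j = 'D_b ('D_a (fun z => g z i j)) y.
    move=> dab; rewrite (derive_mx dab) mxE; apply: near_eq_derive.
    apply: filterS (open_near oU Uy) => z Uz.
    by have [d _] := is_derive_metric a Uz; rewrite (derive_mx d) mxE.
  apply: etrans (ent v u dvu) _; apply: etrans _ (esym (ent u v duv)).
  exact: (C2_derive_comm _ _ oU (gC2 i j) Uy).
by rewrite Euv Evu curvature_metric_identity.
Qed.

(** * Second derivatives of a vector field and Lie derivatives along it *)

Section Field.
Variable Z : E -> E.
Hypothesis ZC2 : forall j, Ck_on 2 U (fun y => Z y 0 j).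

Lemma derive_field_jac_mx w y : U y -> is_derive y w Z (w *m jac_mx Z y).
Proof.
move=> Uy; apply: is_derive_mx => i j; rewrite ord1.
have C1 := Ck_onW (ZC2 j); have [_ [d _]] := C1; split; first exact: d.
by rewrite (C1_derive_coord _ oU C1 Uy) mxE; apply: eq_bigr => k _; rewrite mxE.
Qed.

Definition djac_mx v y : 'M[R]_n :=
  \matrix_(i, j) 'D_v ('D_(basis_vec i) (fun y => Z y 0 j)) y.

Lemma is_derive_jac_mx v y : U y -> is_derive y v (jac_mx Z) (djac_mx v y).
Proof.
move=> Uy; apply: is_derive_mx => i j; rewrite mxE.
have [_ [_ /(_ (basis_vec i))[_ [d _]]]] := ZC2 j.
by under eq_fun do rewrite mxE; apply: derivableP; exact: d.
Qed.

(** Equality of mixed partial derivatives of [Z] along [u] and [v]. *)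
Lemma djac_mx_sym u v y : U y -> u *m djac_mx v y = v *m djac_mx u y.
Proof.
move=> Uy; apply/rowP => j.
have D (a b : E) : (a *m djac_mx b y) 0 j = 'D_b ('D_a (fun z => Z z 0 j)) y.
  have E : \forall z \near y, \sum_i a 0 i * 'D_(basis_vec i) (fun z => Z z 0 j) z =
      'D_a (fun z => Z z 0 j) z.
    apply: filterS (open_near oU Uy) => z Uz.
    by rewrite (C1_derive_coord _ oU (Ck_onW (ZC2 j)) Uz).
  rewrite -(near_eq_derive _ E) mxE.
  have d i : is_derive y b
      (fun z => a 0 i * 'D_(basis_vec i) (fun z => Z z 0 j) z) (a 0 i * djac_mx b y i j).
    have [_ [_ /(_ (basis_vec i))[_ [d _]]]] := ZC2 j.
    apply: is_derive_eq (is_derive_mulr (is_derive_cst (a 0 i) y b) (derivableP (d b y Uy))) _.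
    by rewrite mul0r add0r mxE.
  by have [_ ->] := is_derive_sum_seq (index_enum 'I_n) d.
apply: etrans (D u v) (etrans _ (esym (D v u))).
exact: (C2_derive_comm _ _ oU (ZC2 j) Uy).
Qed.

(** The bracket of [Z] with a constant field [e] is [- (e *m jac_mx Z y)], whence the two Jacobian
    terms. Leaving [T] general lets the formula serve for both [g] and L_Z g. *)
Lemma lie_derivativeE (T : E -> 'M[R]_n) (dT : 'M[R]_n) y : U y ->
  is_derive y (Z y) T dT ->
  lie_derivative Z T y = dT + jac_mx Z y *m T y + T y *m (jac_mx Z y)^T.
Proof.
move=> Uy hT; apply/matrixP => i j.
have ent (S : 'M[R]_n) k l : bilin S (basis_vec k) (basis_vec l) = S k l.
  by rewrite /bilin /basis_vec -rowE trmx_delta -colE !mxE.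
have bra k : bracket Z (cst (basis_vec k)) y = - (basis_vec k *m jac_mx Z y).
  rewrite /bracket derive_cst sub0r.
  by have [_ ->] := derive_field_jac_mx (basis_vec k) Uy.
rewrite mxE !bra (_ : (fun z => _) = (fun z => T z i j)); last first.
  by apply/funext => z; rewrite ent.
have [_ ->] := is_derive_entry i j hT.
have bl (S J : 'M[R]_n) u v : bilin S (- (u *m J)) v = - bilin (J *m S) u v.
  by rewrite /bilin !mulNmx mxE -!mulmxA.
have br (S J : 'M[R]_n) u v : bilin S u (- (v *m J)) = - bilin (S *m J^T) u v.
  by rewrite /bilin linearN /= mulmxN mxE trmx_mul !mulmxA.
by rewrite bl br !opprK !ent [RHS]mxE; congr (_ + _); rewrite [RHS]mxE.
Qed.

End Field.
End Chart.
End LocalFormulas.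

(** * Algebra of bilinear forms at a point *)

Section BilinearForms.
Context {R : realType} {n : nat}.
Implicit Types (T A : 'M[R]_n) (u v : 'rV[R]_n).

Lemma bilinDm T T' u v : bilin (T + T') u v = bilin T u v + bilin T' u v.
Proof. by rewrite /bilin mulmxDr mulmxDl mxE. Qed.

Lemma bilinDl T u u' v : bilin T (u + u') v = bilin T u v + bilin T u' v.
Proof. by rewrite /bilin !mulmxDl mxE. Qed.

Lemma bilinDr T u v v' : bilin T u (v + v') = bilin T u v + bilin T u v'.
Proof. by rewrite /bilin linearD mulmxDr mxE. Qed.

Lemma bilinZl T a u v : bilin T (a *: u) v = a * bilin T u v.
Proof. by rewrite /bilin -!scalemxAl mxE. Qed.

Lemma bilinZr T a u v : bilin T u (a *: v) = a * bilin T u v.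
Proof. by rewrite /bilin linearZ -scalemxAr mxE. Qed.

Lemma bilin0m u v : bilin 0 u v = 0.
Proof. by rewrite /bilin mulmx0 mul0mx mxE. Qed.

Lemma bilin_mull A T u v : bilin (A *m T) u v = bilin T (u *m A) v.
Proof. by rewrite /bilin !mulmxA. Qed.

Lemma bilin_mulr A T u v : bilin (T *m A^T) u v = bilin T u (v *m A).
Proof. by rewrite /bilin trmx_mul !mulmxA. Qed.

Lemma bilinC T u v : T^T = T -> bilin T u v = bilin T v u.
Proof.
move=> Ts; transitivity ((u *m T *m v^T)^T 0 0); first by rewrite mxE.
by rewrite !trmx_mul trmxK Ts mulmxA.
Qed.

Lemma posdef_unitmx T : (forall u, u != 0 -> 0 < bilin T u u) -> T \in unitmx.
Proof.
move=> Tp; rewrite -row_free_unit -kermx_eq0; apply/rowV0P => u /sub_kermxP uT.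
apply/eqP; apply: contraT => /Tp.
by rewrite /bilin uT mul0mx mxE ltxx.
Qed.

Lemma bilin_Cauchy_Schwarz T u v : T^T = T ->
  (forall u, u != 0 -> 0 < bilin T u u) ->
  0 <= bilin T u u * bilin T v v - bilin T u v ^+ 2.
Proof.
move=> Ts Tp.
have Tge0 w : 0 <= bilin T w w.
  by have [->|/Tp/ltW//] := eqVneq w 0; rewrite /bilin !mul0mx mxE.
have [->|/Tp u0] := eqVneq u 0.
  by rewrite /bilin !mul0mx mxE mul0r expr0n subr0.
(* This vector is T(u, u) times the component of [v] orthogonal to [u]; its square is T(u, u) times
   the Gram determinant. *)
have := Tge0 (bilin T u u *: v + (- bilin T u v) *: u).
rewrite !(bilinDl, bilinDr, bilinZl, bilinZr) [bilin T v u]bilinC //.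
move: (bilin T u u) (bilin T u v) (bilin T v v) u0 => a b c a0 H.
by rewrite -(pmulr_rge0 _ a0); move: H; congr (_ <= _); ring.
Qed.

(* [oz], [ov] are the connection matrices in the directions [z], [v], [P] is the
   Jacobian of the field, [a] = D_z ov, [b] = D_v oz, [Nz], [Nv] are the
   derivatives of [N = oz + P], [L] is L_Z g, and the last but one hypothesis is
   L_Z L_Z g = 0. *)
Lemma two_killing_curvature_identity (g oz ov P N Pz Pv Nz Nv a b L Om : 'M[R]_n)
    (z v : 'rV[R]_n) :
  N = oz + P -> L = N *m g + g *m N^T ->
  Om = a - b + ov *m oz - oz *m ov ->
  g^T = g -> v *m oz = z *m ov -> v *m Pz = z *m Pv ->
  v *m Nz = z *m P *m ov + z *m a + v *m Pz ->
  z *m Nv = v *m P *m oz + z *m b + z *m Pv ->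
  v *m P *m N + z *m Nv + z *m N *m ov = 0 ->
  Nz *m g + N *m (oz *m g + g *m oz^T) + ((oz *m g + g *m oz^T) *m N^T + g *m Nz^T)
    + P *m L + L *m P^T = 0 ->
  Om *m g + g *m Om^T = 0 ->
  bilin g (v *m Om) z = bilin g (v *m N) (v *m N).
Proof.
move=> NE LE OmE gs vo vP vNz zNv W LL Oanti.
(* The definition of R(zeta, v) zeta with [v] extended as a constant field: the first two terms are
   nabla_zeta nabla_v zeta, the third comes from [zeta, v] = - D_v zeta, and nabla_v nabla_zeta zeta
   is zero by [W]. *)
have r : v *m Nz + v *m N *m oz + v *m P *m N = z *m Om.
  have -> : v *m P *m N = - (z *m Nv + z *m N *m ov).
    by apply/eqP; rewrite -addr_eq0 addrA; apply/eqP.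
  rewrite vNz zNv OmE NE !(mulmxDl, mulmxDr, mulmxBr) !mulmxN !mulmxA vo vP.
  apply/rowP => j; rewrite !mxE; ring.
(* On (v, v) this will read g(z Om, v) + |v N|^2 = 0 once [r] is used. *)
have := congr1 (fun T => bilin T v v) LL.
rewrite LE bilin0m !(bilinDm, bilin_mulr, bilin_mull).
(* Skewness exchanges g(v Om, z) for - g(z Om, v), which [r] expresses through [N]. *)
have := congr1 (fun T => bilin T z v) Oanti.
rewrite bilin0m bilinDm bilin_mulr bilin_mull -r.
(* Splitting one factor by N = oz + P matches the cross terms of L_Z L_Z g. *)
have -> : bilin g (v *m N) (v *m N) =
    bilin g (v *m N) (v *m oz) + bilin g (v *m N) (v *m P).
  by rewrite -bilinDr -mulmxDr -NE.
rewrite !bilinDl [bilin g z _]bilinC // ![bilin g v _]bilinC //.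
rewrite [bilin g (v *m P) _]bilinC // [bilin g (v *m oz) _]bilinC //.
lra.
Qed.

End BilinearForms.

(** * Nonnegative sectional curvature in one chart *)

Lemma two_killing_sectional_ge0 (R : realType) n (g : 'rV[R]_n -> 'M[R]_n)
    (Z : 'rV[R]_n -> 'rV[R]_n) (U : set 'rV[R]_n) (x v : 'rV[R]_n) :
  open U -> (forall i j, Ck_on 2 U (fun y => g y i j)) ->
  (forall y, U y -> (g y)^T = g y) ->
  (forall y u, U y -> u != 0 -> 0 < bilin (g y) u u) ->
  (forall j, Ck_on 2 U (fun y => Z y 0 j)) ->
  U x -> lie_derivative Z (lie_derivative Z g) x = 0 ->
  cov g v (nabla g Z Z) x = 0 ->
  0 <= sectional g (Z x) v x.
Proof.
move=> oU gC2 gs gp ZC2 Ux LL W.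
have gu y (Uy : U y) : g y \in unitmx by apply: posdef_unitmx => u; exact: gp.
pose N y := conn_mx g (Z y) y + jac_mx Z y.
have dZ w y (Uy : U y) := derive_field_jac_mx oU ZC2 w Uy.
have dN w : is_derive x w N
    (conn_mx g (w *m jac_mx Z x) x + dconn_mx g (Z x) w x + djac_mx Z w x).
  apply: is_deriveD; last exact: is_derive_jac_mx.
  exact: is_derive_conn_mx_field oU gC2 gu _ _ _ _ Ux (dZ w x Ux).
have dg w := is_derive_metric oU gC2 gs gu w Ux.
have LE y : U y -> lie_derivative Z g y = N y *m g y + g y *m (N y)^T.
  move=> Uy.
  rewrite (lie_derivativeE oU ZC2 Uy (is_derive_metric oU gC2 gs gu (Z y) Uy)) /N.
  by rewrite mulmxDl linearD /= mulmxDr -!addrA; congr (_ + _); rewrite addrCA.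
(* The product rule is applied to the formula in [LE] and carried over to [lie_derivative Z g],
   which agrees with it near [x]; then [lie_derivativeE] applies a second time. *)
have dL := is_deriveD (is_derive_mulmx (dN (Z x)) (dg (Z x)))
  (is_derive_mulmx (dg (Z x)) (is_derive_trmx (dN (Z x)))).
have nL : \forall y \near x, N y *m g y + g y *m (N y)^T = lie_derivative Z g y.
  by apply: filterS (open_near oU Ux) => y /LE.
have := lie_derivativeE oU ZC2 Ux (near_eq_is_derive nL dL).
rewrite LL => /esym LL0.
have nW : \forall y \near x, Z y *m N y = nabla g Z Z y.
  apply: filterS (open_near oU Ux) => y Uy; rewrite /nabla covE.
  by have [_ ->] := dZ (Z y) y Uy; rewrite -mulmxDr addrC.
have [_ dW] := near_eq_is_derive nW (is_derive_mulmx (dZ v x Ux) (dN v)).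
move: W; rewrite covE dW -(nbhs_singleton nW) => W.
rewrite /sectional (riemann_cst oU gC2 gu _ _ Ux).
have vo := conn_mx_sym oU gs (Z x) v Ux.
have vP := djac_mx_sym oU ZC2 v (Z x) Ux.
(* Torsion-freeness exchanges vector arguments, so that only connection matrices in the directions
   [Z x] and [v] remain. *)
have vNz : v *m (conn_mx g (Z x *m jac_mx Z x) x + dconn_mx g (Z x) (Z x) x
      + djac_mx Z (Z x) x) =
    Z x *m jac_mx Z x *m conn_mx g v x + Z x *m dconn_mx g v (Z x) x
      + v *m djac_mx Z (Z x) x.
  rewrite !mulmxDr; congr (_ + _ + _).
    exact: (conn_mx_sym oU gs (Z x *m jac_mx Z x) v Ux).
  exact: (dconn_mx_sym oU gC2 gs gu (Z x) (Z x) v Ux).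
have zNv : Z x *m (conn_mx g (v *m jac_mx Z x) x + dconn_mx g (Z x) v x
      + djac_mx Z v x) =
    v *m jac_mx Z x *m conn_mx g (Z x) x + Z x *m dconn_mx g (Z x) v x
      + Z x *m djac_mx Z v x.
  rewrite !mulmxDr; congr (_ + _ + _).
  exact: (conn_mx_sym oU gs (v *m jac_mx Z x) (Z x) Ux).
have anti := curv_mx_antisym oU gC2 gs gu (Z x) v Ux.
rewrite (two_killing_curvature_identity (erefl (N x)) (LE x Ux) (erefl _) (gs x Ux)
  vo vP vNz zNv W LL0 anti).
apply: divr_ge0; last by apply: bilin_Cauchy_Schwarz => [|u]; [exact: gs | exact: gp].
have [->|/(gp x _ Ux)/ltW//] := eqVneq (v *m N x) 0.
by rewrite /bilin !mul0mx mxE.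
Qed.

(** * The warped product metric in product charts *)

Section WarpedMetric.
Context {R : realType} {M1 M2 : atlas_space R}.
Variables (f : M1 -> R) (g1 : metric_comps M1) (g2 : metric_comps M2).
Hypotheses (hM1 : is_smooth_manifold M1) (hM2 : is_smooth_manifold M2).
Hypotheses (hg1 : is_riemannian_metric g1) (hg2 : is_riemannian_metric g2).
Hypotheses (hf : smooth_function f) (f_gt0 : forall p, 0 < f p).
Variable i : chart (product M1 M2).

Lemma chart_img_product :
  chart_img i = lsubmx @^-1` chart_img i.1 `&` rsubmx @^-1` chart_img i.2.
Proof.
apply/seteqP; split=> [_ [[p q] /= [dp dq] <-]|x /= [[p dp px] [q dq qx]]].
  by split=> /=; rewrite (row_mxKl, row_mxKr); [exists p | exists q].
by exists (p, q) => //=; rewrite px qx hsubmxK.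
Qed.

Lemma open_chart_img_product : open (chart_img i).
Proof.
have [_ _ _ c1 _] := hM1; have [_ _ _ c2 _] := hM2.
have [_ o1 _ _ _] := c1 i.1; have [_ o2 _ _ _] := c2 i.2.
rewrite chart_img_product; apply: openI.
  by apply: open_comp o1 => x _; exact: continuous_lsubmx.
by apply: open_comp o2 => x _; exact: continuous_rsubmx.
Qed.

(** Off-diagonal entries are constant, and the diagonal blocks are built from C^k functions pulled
    back from the factors. *)
Lemma warped_metric_Ck_on k a b :
  Ck_on k (chart_img i) (fun x => warped_metric f g1 g2 i x a b).
Proof.
have [_ _ _ c1 _] := hM1; have [_ _ _ c2 _] := hM2.
have [_ o1 _ _ _] := c1 i.1; have [_ o2 _ _ _] := c2 i.2.
have [s1 _ _ _] := hg1; have [s2 _ _ _] := hg2.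
have oU := open_chart_img_product.
have cl (h : 'rV[R]_(mdim M1) -> R) : Ck_on k (chart_img i.1) h ->
    Ck_on k (chart_img i) (h \o lsubmx).
  move=> /(Ck_on_comp_linear (@continuous_lsubmx _ 1 (mdim M1) (mdim M2))).
  by apply: Ck_on_subset; rewrite chart_img_product => x [].
have cr (h : 'rV[R]_(mdim M2) -> R) : Ck_on k (chart_img i.2) h ->
    Ck_on k (chart_img i) (h \o rsubmx).
  move=> /(Ck_on_comp_linear (@continuous_rsubmx _ 1 (mdim M1) (mdim M2))).
  by apply: Ck_on_subset; rewrite chart_img_product => x [].
have Cf := cl _ (hf i.1 k).
case: (splitP a) => a' ea; case: (splitP b) => b' eb.
- have -> : a = lshift _ a' by apply: val_inj.
  have -> : b = lshift _ b' by apply: val_inj.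
  under eq_fun do rewrite block_mxEul.
  exact: cl _ (Ck_on_entry a' b' o1 (s1 i.1 k)).
- have -> : a = lshift _ a' by apply: val_inj.
  have -> : b = rshift _ b' by apply: val_inj.
  by under eq_fun do rewrite block_mxEur mxE; exact: Ck_on_cst.
- have -> : a = rshift _ a' by apply: val_inj.
  have -> : b = lshift _ b' by apply: val_inj.
  by under eq_fun do rewrite block_mxEdl mxE; exact: Ck_on_cst.
have -> : a = rshift _ a' by apply: val_inj.
have -> : b = rshift _ b' by apply: val_inj.
under eq_fun do rewrite block_mxEdr mxE expr2.
exact: Ck_onM oU (Ck_onM oU Cf Cf) (cr _ (Ck_on_entry a' b' o2 (s2 i.2 k))).
Qed.

Lemma warped_metric_sym x : chart_img i x ->
  (warped_metric f g1 g2 i x)^T = warped_metric f g1 g2 i x.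
Proof.
have [_ y1 _ _] := hg1; have [_ y2 _ _] := hg2.
rewrite chart_img_product => -[x1 x2].
by rewrite /warped_metric tr_block_mx !trmx0 linearZ /= y1 // y2.
Qed.

Lemma warped_metric_posdef x u : chart_img i x -> u != 0 ->
  0 < bilin (warped_metric f g1 g2 i x) u u.
Proof.
have [_ _ p1 _] := hg1; have [_ _ p2 _] := hg2.
rewrite chart_img_product => -[x1 x2] u0.
rewrite -[u]hsubmxK warped_metricE.
have f2 : 0 < f (chart_inv i.1 (lsubmx x)) ^+ 2 by rewrite exprn_gt0.
(* A nonzero [u] has a nonzero component in some factor, and both diagonal blocks are positive
   definite. *)
have [l0|l0] := eqVneq (lsubmx u) 0.
  have r0 : rsubmx u != 0.
    by apply: contraNneq u0 => r0; rewrite -[u]hsubmxK l0 r0 row_mx0.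
  by rewrite l0 {1}/bilin !mul0mx mxE add0r mulr_gt0 // p2.
have [r0|r0] := eqVneq (rsubmx u) 0.
  by rewrite r0 [X in _ * X]/bilin !mul0mx mxE mulr0 addr0 p1.
by rewrite addr_gt0 ?p1 // mulr_gt0 // p2.
Qed.

End WarpedMetric.

(** * The curvature inequality along the curve *)

Theorem theorem5 (R : realType) (M1 M2 : atlas_space R)
    (g1 : metric_comps M1) (g2 : metric_comps M2) (f : M1 -> R)
    (zeta : vector_comps (product M1 M2)) (J : set R)
    (gamma : R -> product M1 M2)
    (hM1 : is_smooth_manifold M1) (hM2 : is_smooth_manifold M2)
    (hg1 : is_riemannian_metric g1) (hg2 : is_riemannian_metric g2)
    (hf : smooth_function f) (f_gt0 : forall p, 0 < f p)
    (hzeta : is_vector_field zeta) (zeta_neq0 : nontrivial_field zeta)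
    (zeta_2Killing : two_killing (warped_metric f g1 g2) zeta)
    (hgamma : smooth_curve J gamma)
    (hpar : parallel_along (warped_metric f g1 g2)
              (cov_field (warped_metric f g1 g2) zeta zeta) J gamma) :
  forall t (i : chart (product M1 M2)), J t -> chart_dom i (gamma t) ->
    let x := chart_map i (gamma t) in
    free [:: zeta i x; velocity gamma i t] ->
    0 <= sectional (warped_metric f g1 g2 i) (zeta i x) (velocity gamma i t) x.
Proof.
move=> t i Jt it x _.
have Ux : chart_img i x by exists (gamma t).
have oU := @open_chart_img_product R M1 M2 hM1 hM2 i.
have gC2 := @warped_metric_Ck_on R M1 M2 f g1 g2 hM1 hM2 hg1 hg2 hf i 2.
have gs := @warped_metric_sym _ _ _ f _ _ hg1 hg2 i.
have gp := @warped_metric_posdef _ _ _ _ _ _ hg1 hg2 f_gt0 i.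
have zC2 j := Ck_on_entry 0 j oU (hzeta.1 i 2%N).
(* Parallelism at time [t] is the vanishing of the covariant derivative of nabla_zeta zeta in the
   direction of the velocity. *)
exact: (two_killing_sectional_ge0 oU gC2 gs gp zC2 Ux (zeta_2Killing _ _ Ux)
  (hpar _ Jt _ it)).
Qed.
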